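(* On any class $\mathbb{M}$ of neighborhood models, $\mathcal{L}(\bullet,W)$ is equally expressive as $\mathcal{L}(\Box)$.
   Context: Fix a nonempty set $\mathbf{P}$ of propositional variables, $p\in\mathbf{P}$. $\mathcal{L}(\bullet,W)$: $\varphi::=p\mid\neg\varphi\mid\varphi\land\varphi\mid\bullet\varphi\mid W\varphi$; $\mathcal{L}(\Box)$: $\varphi::=p\mid\neg\varphi\mid\varphi\land\varphi\mid\Box\varphi$. A neighborhood model is $\mathcal{M}=\langle S,N,V\rangle$ with $S$ a nonempty set, $N:S\to\mathcal{P}(\mathcal{P}(S))$, and $V:\mathbf{P}\to\mathcal{P}(S)$. With $\varphi^{\mathcal{M}}=\{s\in S\mid\mathcal{M},s\vDash\varphi\}$: $\mathcal{M},s\vDash p$ iff $s\in V(p)$; Boolean connectives as usual; $\mathcal{M},s\vDash\bullet\varphi$ iff $s\in\varphi^{\mathcal{M}}$ and $\varphi^{\mathcal{M}}\notin N(s)$; $\mathcal{M},s\vDash W\varphi$ iff $\varphi^{\mathcal{M}}\in N(s)$ and $s\notin\varphi^{\mathcal{M}}$; $\mathcal{M},s\vDash\Box\varphi$ iff $\varphi^{\mathcal{M}}\in N(s)$. For languages $\mathcal{L}_1,\mathcal{L}_2$ interpreted on a class $\mathbb{M}$ of models, $\mathcal{L}_1\preceq\mathcal{L}_2$ if for each $\varphi\in\mathcal{L}_1$ there is $\psi\in\mathcal{L}_2$ such that for every $\mathcal{M}\in\mathbb{M}$ and every state $s$ of $\mathcal{M}$: $\mathcal{M},s\vDash\varphi$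 iff $\mathcal{M},s\vDash\psi$. They are equally expressive (on $\mathbb{M}$) if $\mathcal{L}_1\preceq\mathcal{L}_2$ and $\mathcal{L}_2\preceq\mathcal{L}_1$. *)

(* Defs.v *)
From mathcomp Require Import all_boot.
From mathcomp Require Import boolp classical_sets.

Set Implicit Arguments.
Unset Strict Implicit.
Unset Printing Implicit Defensive.

Local Open Scope classical_set_scope.

(* [set T] is [T -> Prop]; by the propositional and functional extensionality
   axioms of boolp, [nbhd s] cannot distinguish coextensive predicates, so it
   is a genuine family of subsets. *)
Record model (P : Type) := Model {
  state :> Type;
  state_nonempty : inhabited state;
  nbhd : state -> set (set state);
  val : P -> set state
}.

Inductive form_bW (P : Type) : Type :=
| bW_var of P
| bW_neg of form_bW P
| bW_and of form_bW P & form_bW P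
| bW_bullet of form_bW P
| bW_W of form_bW P.

Inductive form_box (P : Type) : Type :=
| box_var of P
| box_neg of form_box P
| box_and of form_box P & form_box P
| box_box of form_box P.

Fixpoint sat_bW (P : Type) (M : model P) (s : M) (phi : form_bW P)
    {struct phi} : Prop :=
  match phi with
  | bW_var p => val p s
  | bW_neg psi => ~ sat_bW s psi
  | bW_and psi chi => sat_bW s psi /\ sat_bW s chi
  | bW_bullet psi =>
      let truth := [set t : M | sat_bW t psi] in
      truth s /\ ~ nbhd s truth
  | bW_W psi =>
      let truth := [set t : M | sat_bW t psi] in
      nbhd s truth /\ ~ truth s
  end.

Fixpoint sat_box (P : Type) (M : model P) (s : M) (phi : form_box P)
    {struct phi} : Prop :=
  match phi with
  | box_var p => val p s
  | box_neg psi => ~ sat_box s psi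
  | box_and psi chi => sat_box s psi /\ sat_box s chi
  | box_box psi => nbhd s [set t : M | sat_box t psi]
  end.

Record language (P : Type) := Language {
  formula :> Type;
  sat : forall M : model P, M -> formula -> Prop
}.

Definition L_bullet_W (P : Type) : language P := Language (@sat_bW P).
Definition L_box (P : Type) : language P := Language (@sat_box P).

Definition at_most_as_expressive (P : Type) (C : set (model P))
    (L1 L2 : language P) : Prop :=
  forall phi : L1, exists psi : L2,
    forall M : model P, C M -> forall s : M, sat s phi <-> sat s psi.

Definition equally_expressive (P : Type) (C : set (model P))
    (L1 L2 : language P) : Prop :=
  at_most_as_expressive C L1 L2 /\ at_most_as_expressive C L2 L1.

(* Main.v *)
Require Import Defs.
From mathcomp Require Import all_boot.
From mathcomp Require Import boolp classical_sets.

(** The operators are interdefinable pointwise: [•φ] is [φ ∧ ¬□φ], [Wφ] is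
    [□φ ∧ ¬φ], and conversely [□φ] is [Wφ ∨ (φ ∧ ¬•φ)], by cases on whether [φ]
    holds at the current state. *)

(** These equivalences define recursive translations that mention no model, so they serve every
    class at once. By induction a formula and its translation have the same truth set, hence the
    same membership in [nbhd s]. *)

Fixpoint box_of_bW (P : Type) (phi : form_bW P) : form_box P :=
  match phi with
  | bW_var p => box_var p
  | bW_neg psi => box_neg (box_of_bW P psi)
  | bW_and psi chi => box_and (box_of_bW P psi) (box_of_bW P chi)
  | bW_bullet psi =>
      box_and (box_of_bW P psi) (box_neg (box_box (box_of_bW P psi)))
  | bW_W psi =>
      box_and (box_box (box_of_bW P psi)) (box_neg (box_of_bW P psi))
  end.

Definition bW_or (P : Type) (phi psi : form_bW P) : form_bW P :=
  bW_neg (bW_and (bW_neg phi) (bW_neg psi)).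

Fixpoint bW_of_box (P : Type) (phi : form_box P) : form_bW P :=
  match phi with
  | box_var p => bW_var p
  | box_neg psi => bW_neg (bW_of_box P psi)
  | box_and psi chi => bW_and (bW_of_box P psi) (bW_of_box P chi)
  | box_box psi =>
      let psi' := bW_of_box P psi in
      bW_or P (bW_W psi') (bW_and psi' (bW_neg (bW_bullet psi')))
  end.

(** An equality of propositions, with [s] generalized in the induction, lets [funext IH] identify
    whole truth sets, as rewriting under [nbhd] requires. *)
Lemma sat_box_of_bW (P : Type) (M : model P) (phi : form_bW P) (s : M) :
  sat_box s (box_of_bW P phi) = sat_bW s phi.
Proof.
elim: phi s => [p|phi IH|phi IHphi psi IHpsi|phi IH|phi IH] s //=.
- by rewrite IH.
- by rewrite IHphi IHpsi.
- by rewrite IH (funext IH).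
- by rewrite IH (funext IH).
Qed.

Lemma sat_bW_of_box (P : Type) (M : model P) (phi : form_box P) (s : M) :
  sat_bW s (bW_of_box P phi) = sat_box s phi.
Proof.
elim: phi s => [p|phi IH|phi IHphi psi IHpsi|phi IH] s //=.
- by rewrite IH.
- by rewrite IHphi IHpsi.
(* Where [phi] holds, only the disjunct with [bW_bullet] can hold; where it fails, only the one with
   [bW_W]. Since [bW_or] is a De Morgan encoding, the cases are settled classically. *)
- rewrite IH (funext IH); apply/propext.
  case: (EM (sat_box s phi)); case: (EM (nbhd s (fun t => sat_box t phi)));
    rewrite /mkset; tauto.
Qed.

Theorem proposition3p5 (P : Type) (P_nonempty : inhabited P)
    (C : set (model P)) :
  equally_expressive C (L_bullet_W P) (L_box P).
Proof.
split=> phi.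
- by exists (box_of_bW P phi) => M _ s; rewrite /= sat_box_of_bW.
- by exists (bW_of_box P phi) => M _ s; rewrite /= sat_bW_of_box.
Qed.
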